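(* Let $\pi_1,\dots,\pi_n>0$ with $\sum_i\pi_i=1$ and $\pi_*=\min_i\pi_i$. For every $\epsilon\in(0,1)$ there exist $m\in\mathbb{N}$ and a univariate polynomial $p\in\mathbb{R}[t]$ such that (i) $p(t)\ge 2t^2\,\overline{r_m}(t)$ for all $t\in[0,\pi_*^{-1/2}]$, and (ii) $\sum_{i=1}^n\pi_i\,p(x_i)\le(1+\epsilon)\,\mathrm{Ent}_\pi[x^2]$ for all $x\in S^\pi$.
   Context: $\|x\|_\pi^2=\sum_i\pi_ix_i^2$, $\mathrm{Ent}_\pi[x^2]=\sum_i\pi_ix_i^2\log(x_i^2/\|x\|_\pi^2)$, and $S^\pi=\{x\in\mathbb{R}^n_{\ge0}:\|x\|_\pi^2=1\}$. For $m\ge0$, $\overline{r_m}(t)$ is the $(m+1,m)$ Padé approximant of $\log t$ at $t=1$: the rational function $R/S$ with $\deg R\le m+1$, $\deg S\le m$, $S(1)=1$ and $\log t-R(t)/S(t)=O((t-1)^{2m+2})$ as $t\to 1$. (Its denominator is positive on $(0,\infty)$ and $\overline{r_m}(t)\ge\log t$ for $t>0$.) *)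

(* Defs.v *)
From HB Require Import structures.
From mathcomp Require Import all_boot all_order all_algebra.
From mathcomp Require Import all_classical all_reals all_analysis.
Set Implicit Arguments. Unset Strict Implicit. Unset Printing Implicit Defensive.
Import Order.TTheory GRing.Theory Num.Theory.
Local Open Scope ring_scope.

Definition pinormsq (R : realType) (n : nat) (pi x : 'I_n -> R) : R :=
  \sum_(i < n) pi i * x i ^+ 2.

(* Ent_pi[x^2] = sum_i pi_i x_i^2 log(x_i^2 / ||x||_pi^2)
   (terms with x_i = 0 vanish since x_i^2 = 0 multiplies them) *)
Definition Ent (R : realType) (n : nat) (pi x : 'I_n -> R) : R :=
  \sum_(i < n) pi i * x i ^+ 2 * ln (x i ^+ 2 / pinormsq pi x).

(* pi_* = min_i pi_i  (the default 1 is harmless: all pi_i <= 1 when they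
   are positive and sum to 1, and n >= 1) *)
Definition pistar (R : realType) (n : nat) (pi : 'I_n -> R) : R :=
  \big[Num.min/1]_(i < n) pi i.

Definition IsPadeLog (R : realType) (m : nat) (Rp Sp : {poly R}) : Prop :=
  (size Rp <= m.+2)%N /\ (size Sp <= m.+1)%N /\ Sp.[1] = 1 /\
  (forall t : R, 0 < t -> 0 < Sp.[t]) /\
  exists C delta : R, 0 < delta /\
    forall t : R, 0 < t -> `|t - 1| < delta ->
      `|ln t - Rp.[t] / Sp.[t]| <= C * `|t - 1| ^+ (2 * m + 2).

(* Main.v *)
Require Import Defs.
From HB Require Import structures.
From mathcomp Require Import all_boot all_order all_algebra.
From mathcomp Require Import all_classical all_reals all_analysis.
From mathcomp Require Import ring lra.
Import Order.TTheory GRing.Theory Num.Theory.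
Import numFieldNormedType.Exports.
Local Open Scope ring_scope.
Set Implicit Arguments. Unset Strict Implicit. Unset Printing Implicit Defensive.

(**
On the sphere [\sum pi_i (x_i^2 - 1) = 0], so the entropy is [\sum pi_i g(x_i)]
with [g t = 2 t^2 ln t - t^2 + 1 >= (t - 1)^2].  It therefore suffices to
find [p] with [2 t^2 r_m(t) <= p(t) <= 2 t^2 ln t + eps (t - 1)^2] on [[0, M]],
[M = pistar^(-1/2)].

The Pade denominator is [S = \sum_j C(m,j) C(m+1,j) t^j] and the numerator [N]
solves the companion inhomogeneous hypergeometric equation, so that
[S^2 - t (N' S - N S') = (1 - t)^(2m+1)].  Hence the error [N/S - ln] vanishes
at [1] and has derivative [(t - 1) K(t) / t] with [K = ((1 - t)^m / S)^2].
Likewise there is a polynomial [L] with [L(1) = 0] whose error [L - ln] has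
derivative [(t - 1) (1 - t/M)^m / t].  In both cases [u K(u) = O(1/m)] on
[(0, M]], and the mean value theorem gives [t^2 * error <= eta (t - 1)^2] with
[eta = O(1/m)].  For [m] large, [p = 2 t^2 L + (eps/2) (t - 1)^2] works.
*)

(** * Numerator and denominator of the Pade approximant *)

Section PadePolynomials.
Variables (R : realFieldType) (m : nat).

Definition pade_den_coef (j : nat) : R := ('C(m, j) * 'C(m.+1, j))%:R.

(* The coefficients of a solution [N] of [hypergeom_op (S * ln - N) = 0], [S] being
   the denominator; the solution is unique up to adding a multiple of [S]. *)
Fixpoint pade_num_coef (j : nat) : R :=
  if j is i.+1 then
    ((m%:R - i%:R) * (m%:R + 1 - i%:R) * pade_num_coef i
       + 2 * i.+1%:R * pade_den_coef i.+1
       + (2 * m%:R + 1 - 2 * i%:R) * pade_den_coef i)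
      / i.+1%:R ^+ 2
  else 0.

Definition pade_den : {poly R} := \poly_(j < m.+1) pade_den_coef j.

Definition pade_num0 : {poly R} := \poly_(j < m.+2) pade_num_coef j.

(** The correction solves the homogeneous equation; it makes the numerator vanish at [1], as [ln]
    does. *)
Definition pade_num : {poly R} :=
  pade_num0 - (pade_num0.[1] / pade_den.[1]) *: pade_den.

(** Gauss's operator with parameters [-m], [-m-1], [1]. *)
Definition hypergeom_op (p : {poly R}) : {poly R} :=
  'X * (1 - 'X) * p^`()^`() + (1 + (2 * m%:R)%:P * 'X) * p^`()
  - (m%:R * (m%:R + 1))%:P * p.

Lemma coef_hypergeom_op (p : {poly R}) (j : nat) :
  (hypergeom_op p)`_j = j.+1%:R ^+ 2 * p`_j.+1
    - (m%:R - j%:R) * (m%:R + 1 - j%:R) * p`_j.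
Proof.
have -> : hypergeom_op p = 'X * p^`()^`() - 'X * ('X * p^`()^`()) + p^`()
    + (2 * m%:R)%:P * ('X * p^`()) - (m%:R * (m%:R + 1))%:P * p.
  by rewrite /hypergeom_op; ring.
rewrite !(coefD, coefN, coefCM, coefXM, coef_deriv).
case: j => [|[|j]]; rewrite /= ?coefXM ?coef_deriv /=; ring.
Qed.

Lemma pade_den_coef_gt (j : nat) : (m < j)%N -> pade_den_coef j = 0.
Proof. by move=> h; rewrite /pade_den_coef bin_small. Qed.

Lemma pade_den_coefS (j : nat) :
  j.+1%:R ^+ 2 * pade_den_coef j.+1
  = (m%:R - j%:R) * (m%:R + 1 - j%:R) * pade_den_coef j.
Proof.
case: (leqP j m) => [lejm|ltmj]; last first.
  by rewrite !pade_den_coef_gt ?mulr0 // ltnW.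
rewrite -natrB // -[1]/(1%:R) -natrD addn1 -natrB 1?ltnW // /pade_den_coef.
rewrite -natrX -!natrM; congr _%:R.
have /= e1 := mul_bin_left m j; have /= e2 := mul_bin_left m.+1 j.
by rewrite -mulnn mulnACA e1 e2 mulnACA.
Qed.

Lemma pade_num_coefS (j : nat) :
  j.+1%:R ^+ 2 * pade_num_coef j.+1
  = (m%:R - j%:R) * (m%:R + 1 - j%:R) * pade_num_coef j
    + 2 * j.+1%:R * pade_den_coef j.+1
    + (2 * m%:R + 1 - 2 * j%:R) * pade_den_coef j.
Proof. by rewrite /= mulrC divfK // expf_neq0 // pnatr_eq0. Qed.

(** At [j = m.+1] the factor [m + 1 - j] and both source terms of the recurrence vanish, so the
    series for the numerator terminates. *)
Lemma pade_num_coef_gt (j : nat) : (m.+1 < j)%N -> pade_num_coef j = 0.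
Proof.
elim: j => // j IH; rewrite ltnS => ltmj.
have jj : j.+1%:R ^+ 2 != 0 :> R by rewrite expf_neq0 // pnatr_eq0.
apply: (mulfI jj); rewrite pade_num_coefS.
rewrite !pade_den_coef_gt // 1?ltnW // !mulr0 !addr0.
move: ltmj; rewrite leq_eqVlt => /predU1P[<-|/IH ->]; last by rewrite mulr0.
by rewrite -natr1 subrr mulr0 mul0r.
Qed.

Lemma coef_pade_den j : pade_den`_j = pade_den_coef j.
Proof. by rewrite coef_poly; case: ltnP => // /pade_den_coef_gt. Qed.

Lemma coef_pade_num0 j : pade_num0`_j = pade_num_coef j.
Proof. by rewrite coef_poly; case: ltnP => // h; rewrite pade_num_coef_gt. Qed.

Lemma hypergeom_op_den : hypergeom_op pade_den = 0.
Proof.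
apply/polyP => j.
by rewrite coef_hypergeom_op !coef_pade_den pade_den_coefS subrr coef0.
Qed.

Lemma hypergeom_opD p q : hypergeom_op (p + q) = hypergeom_op p + hypergeom_op q.
Proof. by rewrite /hypergeom_op !derivD; ring. Qed.

Lemma hypergeom_opZ c p : hypergeom_op (c *: p) = c *: hypergeom_op p.
Proof. by rewrite /hypergeom_op !derivZ -!mul_polyC; ring. Qed.

(** The right side is what the product rule gives for the operator applied to [S * ln], since
    [S = pade_den] lies in its kernel. *)
Lemma hypergeom_op_num :
  hypergeom_op pade_num
  = 2 * (1 - 'X) * pade_den^`() + (2 * m%:R + 1)%:P * pade_den.
Proof.
rewrite /pade_num -scaleNr hypergeom_opD hypergeom_opZ hypergeom_op_den.
rewrite scaler0 addr0.
have -> : 2 * (1 - 'X) * pade_den^`()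
    = 2%:P * pade_den^`() - 2%:P * ('X * pade_den^`()) :> {poly R}.
  by rewrite polyC_natr; ring.
apply/polyP => j; rewrite coef_hypergeom_op !coef_pade_num0 pade_num_coefS.
rewrite !(coefD, coefN, coefCM, coefXM, coef_deriv) !coef_pade_den.
case: j => [|j]; rewrite /= ?coef_deriv ?coef_pade_den; ring.
Qed.

(** This is [t] times the Wronskian of [S] and [S * ln - N], in which the logarithm cancels. *)
Definition pade_wronskian : {poly R} :=
  pade_den ^+ 2 - 'X * (pade_num^`() * pade_den - pade_num * pade_den^`()).

(** Abel's identity: cross-multiplying the two second-order equations by [N] and [D] leaves a
    first-order one. *)
Lemma deriv_pade_wronskian :
  (1 - 'X) * pade_wronskian^`() = - (2 * m + 1)%:R * pade_wronskian.
Proof.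
have := hypergeom_op_den; have := hypergeom_op_num.
rewrite /hypergeom_op /pade_wronskian; move: (pade_num) (pade_den) => N D.
rewrite !(polyCM, polyCD, polyC_natr).
set rhs := 2 * _ * _ + _; set e1 := (X in X = rhs -> _).
set e2 := (X in _ -> X = 0 -> _) => nE dE.
apply/eqP; rewrite -subr_eq0; apply/eqP.
transitivity (N * e2 - D * (e1 - rhs)); last by rewrite dE nE; ring.
rewrite expr2 !(derivB, derivM) derivX /e1 /e2 /rhs natrD natrM.
ring.
Qed.

Lemma pade_wronskianE : pade_wronskian = (1 - 'X) ^+ (2 * m + 1).
Proof.
set k := (2 * m + 1)%N; set d := pade_wronskian - (1 - 'X) ^+ k.
suff d0 : d = 0 by apply/eqP; rewrite -subr_eq0 -/d d0.
have dd : d^`() - 'X * d^`() = (- k%:R)%:P * d.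
  transitivity ((1 - 'X) * d^`()); first by ring.
  rewrite {1}/d derivB mulrBr deriv_pade_wronskian -/k deriv_exp derivB derivX.
  rewrite derivC /d polyCN polyC_natr /k addn1 [X in _ = X]mulrBr exprS /=.
  move: (_ ^+ (2 * m)) => a; ring.
(* The equation [dd] reads [(j + 1) d_(j+1) = (j - k) d_j], so the constant term determines [d], and
   it is [1 - 1]. *)
apply/polyP => j; rewrite coef0; elim: j => [|j IH].
  rewrite -horner_coef0 /d /pade_wronskian !hornerE /= !horner_coef0 coef_pade_den.
  by rewrite /pade_den_coef !bin0 muln1 !subr0 !expr1n subrr.
move/polyP/(_ j): dd.
rewrite coefB coefXM coefCM IH mulr0 coef_deriv.
case: eqP => [-> /eqP|/eqP j0]; first by rewrite subr0 mulrn_eq0 /= => /eqP.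
rewrite coef_deriv prednK ?lt0n // IH mul0rn subr0.
by move/eqP; rewrite mulrn_eq0 => /eqP.
Qed.

Lemma horner_pade_wronskian (u : R) :
  pade_den.[u] ^+ 2
    - u * (pade_num^`().[u] * pade_den.[u] - pade_num.[u] * pade_den^`().[u])
  = (1 - u) * ((1 - u) ^+ m) ^+ 2.
Proof.
have := congr1 (fun p => p.[u]) pade_wronskianE; rewrite /pade_wronskian.
move: (pade_num) (pade_den) => N D h; rewrite !hornerE in h; rewrite h.
by rewrite -exprM -exprS muln2 addn1 mul2n.
Qed.

Lemma size_pade_den : (size pade_den <= m.+1)%N.
Proof. exact: size_poly. Qed.

Lemma size_pade_num : (size pade_num <= m.+2)%N.
Proof.
apply: leq_trans (size_polyD _ _) _; rewrite geq_max size_poly /= size_polyN.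
by apply: leq_trans (size_scale_leq _ _) _; rewrite ltnW // ltnS size_pade_den.
Qed.

(** Coefficientwise comparison with the binomial expansion, as ['C(m.+1, j) >= 1]. *)
Lemma pade_den_ge (t : R) : 0 <= t -> (1 + t) ^+ m <= pade_den.[t].
Proof.
move=> t0; rewrite horner_poly exprDn.
apply: ler_sum => j _; rewrite expr1n mul1r -mulr_natl ler_wpM2r ?exprn_ge0 //.
by rewrite ler_nat leq_pmulr // bin_gt0 ltnW // ltn_ord.
Qed.

Lemma pade_den_ge1 (t : R) : 0 <= t -> 1 <= pade_den.[t].
Proof.
by move=> t0; apply: le_trans (pade_den_ge t0); rewrite exprn_ege1 // lerDl.
Qed.

Lemma pade_num1 : pade_num.[1] = 0.
Proof.
have d1 : pade_den.[1] != 0 by rewrite gt_eqF // (lt_le_trans ltr01) // pade_den_ge1.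
by rewrite /pade_num !hornerE divfK // subrr.
Qed.
End PadePolynomials.

(** * Elementary estimates and the polynomial approximation of [ln] *)

Lemma bernoulli_decay (R : realFieldType) (m : nat) (y : R) :
  0 <= y -> y <= 1 -> m%:R * (y * (1 - y) ^+ m) <= 1.
Proof.
move=> y0 y1; have q0 k : 0 <= (1 - y) ^+ k by rewrite exprn_ge0 // subr_ge0.
(* The induction rests on [(1 - y) (1 + (m + 1) y) <= 1 + m y]. *)
suff h : (1 - y) ^+ m * (1 + m%:R * y) <= 1.
  by have := q0 m; move: h; move: (_ ^+ m) => q; nra.
elim: m => [|m IH]; first by rewrite mul0r addr0 mulr1 expr0.
apply: le_trans IH; rewrite exprSr -mulrA ler_wpM2l // -natr1.
have : 0 <= m%:R :> R by [].
by move: (m%:R) => a a0; nra.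
Qed.

Lemma poly_primitive (R : numFieldType) (q : {poly R}) :
  exists2 L : {poly R}, L.[1] = 0 & L^`() = q.
Proof.
pose P := \poly_(i < (size q).+1) (q`_i.-1 / i%:R).
exists (P - P.[1]%:P); first by rewrite !hornerE subrr.
rewrite derivB derivC subr0; apply/polyP => i.
rewrite coef_deriv coef_poly ltnS /=; case: ltnP => [_|h].
  by rewrite -[LHS]mulr_natr divfK // pnatr_eq0.
by rewrite mul0rn nth_default.
Qed.

(** The polynomial [1 + (u - 1) (1 - u/M)^m] vanishes at [0], so it can be divided by [u] and
    integrated. *)
Lemma exists_log_poly (R : numFieldType) (M : R) (m : nat) :
  exists2 L : {poly R}, L.[1] = 0 &
    forall u, u != 0 -> L^`().[u] = u^-1 + (u - 1) * (1 - u / M) ^+ m / u.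
Proof.
pose q : {poly R} := 1 + ('X - 1) * (1 - M^-1 *: 'X) ^+ m.
have /factor_theorem[q1 q1E] : root q 0.
  by rewrite /root /q !hornerE /= ?mulr0 ?subr0 ?expr1n ?mulr1 ?sub0r ?subrr.
have [L L1 dL] := poly_primitive q1; exists L => // u u0.
have : q.[u] = q1.[u] * u by rewrite q1E !hornerE ?subr0.
rewrite /q !hornerE /= dL => qu.
by apply: (mulIf u0); rewrite -qu [RHS]mulrDl mulVf // divfK // [M^-1 * u]mulrC.
Qed.

Lemma MVT_from1 (R : realType) (f df : R -> R) (t : R) :
  0 < t -> f 1 = 0 -> (forall u : R, 0 < u -> is_derive u 1 f (df u)) ->
  exists2 c, t <= c <= 1 \/ 1 <= c <= t & f t = df c * (t - 1).
Proof.
move=> t0 f1 fd.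
have fc (a b : R) : 0 < a -> {within `[a, b], continuous f}%classic.
  move=> a0; apply: derivable_within_continuous => u.
  rewrite in_itv /= => /andP[au _].
  by have fu := fd u (lt_le_trans a0 au); exact: ex_derive.
have fd' (a b : R) : 0 < a -> forall u, u \in `]a, b[%R -> is_derive u 1 f (df u).
  by move=> a0 u /[!in_itv]/= /andP[au _]; apply: fd; apply: lt_trans au.
have [t1|/ltW t1] := leP t 1.
  have [c /[!in_itv]/= ct e] := MVT_segment t1 (fd' _ _ t0) (fc _ _ t0).
  exists c; first by left.
  by rewrite -[f t]opprK -[- f t]add0r -f1 e -mulrN opprB.
have [c /[!in_itv]/= ct e] := MVT_segment t1 (fd' _ _ ltr01) (fc _ _ ltr01).
by exists c; [right|rewrite -e f1 subr0].
Qed.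

Lemma log_error_bound (R : realType) (f K : R -> R) (M kappa t : R) :
  1 <= M -> f 1 = 0 ->
  (forall u : R, 0 < u -> is_derive u 1 f ((u - 1) * K u / u)) ->
  (forall u : R, 0 < u <= M -> 0 <= K u /\ u * K u <= kappa) ->
  0 < t <= M -> 0 <= f t /\ t ^+ 2 * f t <= M ^+ 2 * kappa * (t - 1) ^+ 2.
Proof.
move=> M1 f1 fd Kb /andP[t0 tM].
have [c hc ->] := MVT_from1 t0 f1 fd.
have c0M : 0 < c <= M.
  case: hc => /andP[h1 h2]; first by rewrite (lt_le_trans t0) // (le_trans h2).
  by rewrite (lt_le_trans ltr01) // (le_trans h2).
have c0 : 0 < c by case/andP: c0M.
have [Kc cK] := Kb _ c0M.
pose a := K c / c.
have a0 : 0 <= a by rewrite divr_ge0 // ltW.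
have ca : c ^+ 2 * a <= kappa by rewrite /a mulrCA expr2 mulfK ?gt_eqF // mulrC.
have k0 : 0 <= kappa by apply: le_trans ca; rewrite mulr_ge0 // sqr_ge0.
have -> : (c - 1) * K c / c * (t - 1) = a * ((c - 1) * (t - 1)).
  by rewrite /a; ring.
have s0 : 0 <= (c - 1) * (t - 1).
  by case: hc => /andP[h1 h2]; [apply: mulr_le0|apply: mulr_ge0]; lra.
have s1 : (c - 1) * (t - 1) <= (t - 1) ^+ 2 by case: hc => /andP[h1 h2]; nra.
split; first exact: mulr_ge0.
rewrite mulrA; apply: ler_pM => //; first by rewrite mulr_ge0 // sqr_ge0.
(* If [t <= c] then [t^2 a <= c^2 a <= kappa]; if [1 <= c] then [a <= c^2 a <= kappa] and
   [t^2 <= M^2]. *)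
case: hc => /andP[h1 h2].
  apply: le_trans (_ : kappa <= _); last by rewrite ler_peMl // exprn_ege1.
  by apply: le_trans ca; rewrite ler_wpM2r // lerXn2r ?nnegrE // ltW.
apply: ler_pM => //; first exact: sqr_ge0.
  by rewrite lerXn2r ?nnegrE // ltW // (lt_le_trans ltr01).
by apply: le_trans ca; rewrite ler_peMl // exprn_ege1.
Qed.

(** Follows from [ln t >= 1 - 1/t]; it lets errors of order [(t - 1)^2] be charged to the
    entropy. *)
Lemma ent_density_ge (R : realType) (t : R) : 0 < t ->
  (t - 1) ^+ 2 <= 2 * t ^+ 2 * ln t - t ^+ 2 + 1.
Proof.
move=> t0; have h : - ln t <= t^-1 - 1.
  rewrite -lnV ?posrE // -[X in ln X](subrK 1) addrC le_ln1Dx //.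
  by rewrite ltrBDr addrC subrr invr_gt0.
have : t ^+ 2 * (- ln t) <= t ^+ 2 * (t^-1 - 1) by rewrite ler_wpM2l // sqr_ge0.
have -> : t ^+ 2 * (t^-1 - 1) = t - t ^+ 2 by field; rewrite gt_eqF.
nra.
Qed.

(** * Error of the Pade approximant *)

Section PadeError.
Variables (R : realType) (m : nat).
Local Notation N := (pade_num R m).
Local Notation D := (pade_den R m).

Definition pade_weight (u : R) : R := ((1 - u) ^+ m / D.[u]) ^+ 2.

Lemma pade_den_gt0 (u : R) : 0 <= u -> 0 < D.[u].
Proof. by move=> u0; rewrite (lt_le_trans ltr01) // pade_den_ge1. Qed.

Lemma is_derive_pade_error (u : R) : 0 < u ->
  is_derive u 1 (fun t => N.[t] / D.[t] - ln t)
    ((u - 1) * pade_weight u / u).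
Proof.
move=> u0; have d0 : D.[u] != 0 by rewrite gt_eqF // pade_den_gt0 // ltW.
have un0 : u != 0 by rewrite gt_eqF.
have dl := is_derive1_ln u0; have dn := is_derive_poly N u.
have dd := is_deriveV d0 (is_derive_poly D u).
apply: (is_derive_eq (is_deriveB (is_deriveM dn dd) dl)).
rewrite /pade_weight /GRing.scale /= expr_div_n.
have -> : (u - 1) * (((1 - u) ^+ m) ^+ 2 / D.[u] ^+ 2) / u
  = - ((1 - u) * ((1 - u) ^+ m) ^+ 2) / D.[u] ^+ 2 / u by ring.
by rewrite -horner_pade_wronskian; field; rewrite ?d0 ?un0.
Qed.

Lemma pade_error1 : N.[1] / D.[1] - ln 1 = 0 :> R.
Proof. by rewrite pade_num1 mul0r ln1 subrr. Qed.

Lemma pade_weight_bound (M u : R) : (0 < m)%N -> 1 <= M -> 0 < u <= M ->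
  0 <= pade_weight u /\ u * pade_weight u <= M ^+ 2 / m%:R.
Proof.
move=> m0 M1 /andP[u0 uM]; split; first exact: sqr_ge0.
have up : 0 < 1 + u by lra.
(* With this [y], [1 - y = ((1 - u)/(1 + u))^2], so [pade_den_ge] bounds the weight by [(1 - y)^m];
   the leftover factor [u / y = (1 + u)^2 / 4] is at most [M^2]. *)
pose y := 4 * u / (1 + u) ^+ 2.
have y0 : 0 <= y by rewrite divr_ge0 ?sqr_ge0 // mulr_ge0 // ltW.
have y1E : 1 - y = ((1 - u) / (1 + u)) ^+ 2 by rewrite /y; field; rewrite gt_eqF.
have y1 : y <= 1 by rewrite -subr_ge0 y1E sqr_ge0.
have Kle : pade_weight u <= (1 - y) ^+ m.
  rewrite y1E /pade_weight -exprM mulnC exprM !expr_div_n.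
  have d0 := pade_den_gt0 (ltW u0).
  rewrite ler_wpM2l ?sqr_ge0 // lef_pV2 ?posrE ?exprn_gt0 //.
  by rewrite lerXn2r ?nnegrE ?exprn_ge0 ?pade_den_ge ?(ltW up) ?(ltW u0) ?(ltW d0).
rewrite ler_pdivlMr ?ltr0n // mulrC.
have := bernoulli_decay m y0 y1.
have uE : u = y * ((1 + u) ^+ 2 / 4) by rewrite /y; field; rewrite gt_eqF.
have c0 : 0 <= (1 + u) ^+ 2 / 4 by rewrite divr_ge0 ?sqr_ge0.
have cM : (1 + u) ^+ 2 / 4 <= M ^+ 2 by nra.
move=> h; apply: le_trans cM.
apply: le_trans (_ : m%:R * (u * (1 - y) ^+ m) <= _).
  by rewrite ler_wpM2l // ler_wpM2l // ltW.
rewrite [X in X * _ ^+ m]uE -[X in _ <= X]mul1r.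
have -> : m%:R * (y * ((1 + u) ^+ 2 / 4) * (1 - y) ^+ m)
  = m%:R * (y * (1 - y) ^+ m) * ((1 + u) ^+ 2 / 4) by ring.
exact: ler_wpM2r.
Qed.

Lemma pade_ratioE (t : R) :
  (D.[1]^-1 *: N).[t] / (D.[1]^-1 *: D).[t] = N.[t] / D.[t].
Proof.
have d1 : D.[1]^-1 != 0 by rewrite invr_eq0 gt_eqF // pade_den_gt0.
by rewrite !hornerZ -mulf_div divff // mul1r.
Qed.

Lemma pade_log : IsPadeLog m (D.[1]^-1 *: N) (D.[1]^-1 *: D).
Proof.
have d1 := pade_den_gt0 ler01.
split; first by apply: leq_trans (size_scale_leq _ _) (size_pade_num _ _).
split; first by apply: leq_trans (size_scale_leq _ _) (size_pade_den _ _).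
split; first by rewrite hornerZ mulVf // gt_eqF.
split=> [t t0|]; first by rewrite hornerZ mulr_gt0 ?invr_gt0 // pade_den_gt0 // ltW.
(* Within [1/2] of [1] the mean value point has [1/c <= 2], and [D.[c] >= 1], whence the constant
   [2]. *)
exists 2, 2^-1; split; first by rewrite invr_gt0.
move=> t t0; rewrite pade_ratioE ltr_norml => /andP[t1 t2].
have [c hc e] := MVT_from1 t0 pade_error1 is_derive_pade_error.
have c2 : 2^-1 <= c by case: hc => /andP[h1 h2]; lra.
have c0 : 0 < c by lra.
have dc : 1 <= D.[c] by rewrite pade_den_ge1 // ltW.
rewrite distrC e normrM addn2 [_ ^+ (2 * m).+2]exprSr [2 * _]mulrA.
rewrite ler_wpM2r //.
have -> : (c - 1) * pade_weight c / c = - (1 - c) ^+ (2 * m).+1 / (D.[c] ^+ 2 * c).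
  rewrite /pade_weight [_ ^+ (2 * m).+1]exprS mul2n -muln2 exprM.
  by field; rewrite !gt_eqF // pade_den_gt0 // ltW.
rewrite normrM normrN normrX mulrC; apply: ler_pM => //.
  rewrite normfV invf_ple ?posrE //; last first.
    by rewrite normr_gt0 mulf_neq0 ?expf_neq0 // gt_eqF // pade_den_gt0 // ltW.
  rewrite ger0_norm; last by rewrite mulr_ge0 ?sqr_ge0 // ltW.
  by apply: le_trans c2 _; rewrite ler_peMl ?exprn_ege1 // ltW.
rewrite lerXn2r ?nnegrE //.
case: hc => /andP[h1 h2].
  by rewrite ger0_norm ?ler0_norm; lra.
by rewrite ler0_norm ?ger0_norm; lra.
Qed.
End PadeError.

(** * Both errors made uniformly small on [(0, M]] *)

Lemma log_poly_bound (R : realType) (M eta : R) (m : nat) :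
  (0 < m)%N -> 1 <= M -> M ^+ 4 / m%:R <= eta ->
  exists L : {poly R}, forall t, 0 < t <= M ->
    ln t <= L.[t] /\ t ^+ 2 * (L.[t] - ln t) <= eta * (t - 1) ^+ 2.
Proof.
move=> m0 M1 me; have [L L1 dL] := exists_log_poly M m; exists L => t tM.
have fd (u : R) : 0 < u -> is_derive u 1 (fun t => L.[t] - ln t)
    ((u - 1) * (1 - u / M) ^+ m / u).
  move=> u0; have dl := is_derive1_ln u0.
  apply: (is_derive_eq (is_deriveB (is_derive_poly L u) dl)).
  by rewrite dL ?gt_eqF // addrAC subrr add0r.
have M0 : 0 < M by rewrite (lt_le_trans ltr01).
have Kb (u : R) : 0 < u <= M ->
    0 <= (1 - u / M) ^+ m /\ u * (1 - u / M) ^+ m <= M ^+ 2 / m%:R.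
  move=> /andP[u0 uM]; have y0 : 0 <= u / M by rewrite divr_ge0 // ltW.
  have y1 : u / M <= 1 by rewrite ler_pdivrMr // mul1r.
  split; first by rewrite exprn_ge0 // subr_ge0.
  have := bernoulli_decay m y0 y1; move: (_ ^+ m) => q h.
  rewrite ler_pdivlMr ?ltr0n // [u * q * _]mulrC.
  have -> : m%:R * (u * q) = m%:R * (u / M * q) * M by field; rewrite gt_eqF.
  (* The available bound [M / m] is weakened to [M^2 / m], so that one threshold on [m] serves both
     errors. *)
  rewrite expr2; apply: ler_wpM2r; first exact: ltW.
  exact: le_trans M1.
have [|h1 h2] := log_error_bound M1 _ fd Kb tM; first by rewrite L1 ln1 subrr.
split; first by rewrite -subr_ge0.
apply: le_trans h2 _; rewrite ler_wpM2r ?sqr_ge0 //.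
by apply: le_trans me; rewrite mulrA -exprD.
Qed.

Lemma pade_log_bound (R : realType) (M eta t : R) (m : nat) :
  (0 < m)%N -> 1 <= M -> M ^+ 4 / m%:R <= eta -> 0 < t <= M ->
  t ^+ 2 * ((pade_num R m).[t] / (pade_den R m).[t] - ln t)
    <= eta * (t - 1) ^+ 2.
Proof.
move=> m0 M1 me tM.
have [_ h] := log_error_bound M1 (pade_error1 R m) (@is_derive_pade_error R m)
  (fun u => @pade_weight_bound R m M u m0 M1) tM.
apply: le_trans h _; rewrite ler_wpM2r ?sqr_ge0 //.
by apply: le_trans me; rewrite mulrA -exprD.
Qed.

(** * Coordinates and entropy on the sphere *)

Section Sphere.
Variables (R : realType) (n : nat) (pi : 'I_n -> R).
Hypotheses (hpos : forall i, 0 < pi i) (hsum : \sum_(i < n) pi i = 1).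

Lemma pistar_gt0 : 0 < pistar pi.
Proof. by apply: lt_bigmin. Qed.

Lemma sphere_radius_ge1 : 1 <= (Num.sqrt (pistar pi))^-1.
Proof.
rewrite invf_ge1 ?sqrtr_gt0 ?pistar_gt0 // -[leRHS]sqrtr1 ler_wsqrtr //.
(* The default value [1] of the minimum gives [pistar pi <= 1]. *)
exact: bigmin_le_id.
Qed.

Lemma sphere_coord_le (x : 'I_n -> R) (i : 'I_n) :
  0 <= x i -> pinormsq pi x = 1 -> x i <= (Num.sqrt (pistar pi))^-1.
Proof.
move=> xi0 xS; have p0 := pistar_gt0.
rewrite -[x i]ger0_norm // -sqrtr_sqr -sqrtrV ?(ltW p0) // ler_wsqrtr //.
rewrite -[_^-1]mul1r ler_pdivlMr // mulrC.
apply: le_trans (_ : pi i * x i ^+ 2 <= _).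
  by rewrite ler_wpM2r ?sqr_ge0 // bigmin_le.
rewrite -xS /pinormsq (bigD1 i) //= lerDl.
by apply: sumr_ge0 => j _; rewrite mulr_ge0 ?sqr_ge0 // ltW.
Qed.

(** The weighted sum of [1 - x_i^2] is zero; adding it allows a termwise comparison with the
    entropy. *)
Lemma sphere_sum_shift (x F : 'I_n -> R) : pinormsq pi x = 1 ->
  \sum_(i < n) pi i * F i = \sum_(i < n) pi i * (F i - x i ^+ 2 + 1).
Proof.
move=> xS; under [RHS]eq_bigr do rewrite mulrDr mulrBr mulr1.
by rewrite big_split sumrB /= hsum -[X in _ - X]/(pinormsq pi x) xS subrK.
Qed.

Lemma sphere_EntE (x : 'I_n -> R) : (forall i, 0 <= x i) ->
  pinormsq pi x = 1 ->
  Ent pi x = \sum_(i < n) pi i * (2 * x i ^+ 2 * ln (x i) - x i ^+ 2 + 1).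
Proof.
move=> x0 xS; rewrite -sphere_sum_shift // /Ent xS; apply: eq_bigr => i _; rewrite divr1.
have := x0 i; rewrite le_eqVlt => /predU1P[<-|xi].
  by rewrite expr0n !(mulr0, mul0r).
by rewrite lnXn // -mulr_natl; ring.
Qed.
End Sphere.

(** * Choice of [m] and [p] *)

Theorem mainTheorem4 (R : realType) (n : nat) (pi : 'I_n -> R)
  (hpos : forall i, 0 < pi i) (hsum : \sum_(i < n) pi i = 1)
  (eps : R) (heps0 : 0 < eps) (heps1 : eps < 1) :
  exists (m : nat) (p : {poly R}) (Rp Sp : {poly R}),
    IsPadeLog m Rp Sp /\
    (forall t : R, 0 <= t -> t <= (Num.sqrt (pistar pi))^-1 ->
       2 * t ^+ 2 * (Rp.[t] / Sp.[t]) <= p.[t]) /\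
    (forall x : 'I_n -> R, (forall i, 0 <= x i) -> pinormsq pi x = 1 ->
       \sum_(i < n) pi i * p.[x i] <= (1 + eps) * Ent pi x).
Proof.
set M := (Num.sqrt (pistar pi))^-1.
have M1 : 1 <= M by exact: sphere_radius_ge1.
(* The target [eps / 4] becomes [eps / 2] after the factor [2] in [2 t^2]. *)
pose m := (Num.trunc (M ^+ 4 / (eps / 4))).+1.
have m0 : (0 < m)%N by [].
have me : M ^+ 4 / m%:R <= eps / 4.
  rewrite ler_pdivrMr ?ltr0n // mulrC -ler_pdivrMr ?divr_gt0 //.
  exact/ltW/truncnS_gt.
have [L LP] := log_poly_bound m0 M1 me.
(* The square term absorbs the Pade error; together with the error of [L] it costs at most
   [eps (t - 1)^2]. *)
pose p : {poly R} := 2%:P * 'X^2 * L + (eps / 2)%:P * ('X - 1) ^+ 2.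
have pE t : p.[t] = 2 * t ^+ 2 * L.[t] + eps / 2 * (t - 1) ^+ 2.
  by rewrite /p; move: L {LP p} => L; rewrite !hornerE.
exists m, p, ((pade_den R m).[1]^-1 *: pade_num R m),
  ((pade_den R m).[1]^-1 *: pade_den R m).
split; first exact: pade_log.
split=> [t|x x0 xS].
  rewrite le_eqVlt pade_ratioE pE => /predU1P[<- _|t0 tM].
    rewrite expr0n /= !(mulr0, mul0r) add0r.
    by rewrite mulr_ge0 ?sqr_ge0 // divr_ge0 // ltW.
  have tM' : 0 < t <= M by rewrite t0.
  have := pade_log_bound m0 M1 me tM'; have [+ _] := LP t tM'.
  have := sqr_ge0 t; move: (_ / _) (ln t) => r l s0 h1 h2.
  have : t ^+ 2 * l <= t ^+ 2 * L.[t] by rewrite ler_wpM2l.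
  nra.
rewrite (sphere_EntE hsum x0 xS) (sphere_sum_shift hsum _ xS) mulr_sumr.
apply: ler_sum => i _; rewrite mulrCA ler_wpM2l ?(ltW (hpos i)) // pE.
have := sphere_coord_le hpos (x0 i) xS; rewrite -/M => xM.
(* The logarithmic bounds need [x i > 0]; at [0] the claim is [eps / 2 + 1 <= 1 + eps]. *)
have := x0 i; rewrite le_eqVlt => /predU1P[<-|t0].
  by lra.
have tM' : 0 < x i <= M by rewrite t0.
have [_ h1] := LP _ tM'; have h2 := ent_density_ge t0.
have h3 : eps * (x i - 1) ^+ 2
    <= eps * (2 * x i ^+ 2 * ln (x i) - x i ^+ 2 + 1) by rewrite ler_wpM2l // ltW.
lra.
Qed.
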